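(* Let $d$ be a positive integer, let $H$ be a finite set of unit vectors in $\mathbb{R}^d$ not contained in any closed half of the unit sphere, let $k=|H|$, and let $\alpha\in(0,1)$. There exists $\beta=\beta(\alpha,d,k)>0$ such that the following holds. If $S$ is a finite set in $\mathbb{R}^d$ and $\mathcal{B}$ is a finite family of $H$-convex sets such that at least $\alpha\binom{|\mathcal{B}|}{d+1}$ of the $(d+1)$-element subfamilies of $\mathcal{B}$ have intersection containing a point of $S$, then there is a subfamily of at least $\beta|\mathcal{B}|$ sets of $\mathcal{B}$ whose intersection contains a point of $S$.
   Context: For a set $H\subseteq S^{d-1}$ of unit vectors not contained in any closed half-sphere, a set in $\mathbb{R}^d$ is $H$-convex if it can be written as an intersection of halfspaces of the form $\{x\in\mathbb{R}^d:\langle x,h\rangle\le c\}$ with $h\in H$ and $c\in\mathbb{R}$.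
   Formalization: The formal theorem assumes that the family B has at least d+1 members; with fewer members the hypothesis on (d+1)-element subfamilies is vacuous and the claim fails, for example when S is empty. *)

(* Defs.v *)
From HB Require Import structures.
From mathcomp Require Import all_boot all_order all_algebra finmap.
From mathcomp Require Import mathcomp_extra boolp classical_sets reals.

Set Implicit Arguments.
Unset Strict Implicit.
Unset Printing Implicit Defensive.

Import Order.TTheory GRing.Theory Num.Theory.

Local Open Scope classical_set_scope.
Local Open Scope ring_scope.

Section HConvex.
Context {R : realType} {d : nat}.
Implicit Types (x y h u : 'rV[R]_d) (c : R).

Definition dot x y : R := \sum_(i < d) x 0 i * y 0 i.

(* The canonical norm `|x| of MathComp-Analysis on matrices is the sup norm,
   hence a separate Euclidean norm. *)
Definition enorm x : R := Num.sqrt (dot x x).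

Definition unit_sphere : set 'rV[R]_d := [set x | enorm x = 1].

Definition closed_half_sphere u : set 'rV[R]_d :=
  unit_sphere `&` [set x | 0 <= dot x u].

Definition halfspace h c : set 'rV[R]_d := [set x | dot x h <= c].

(* F may be infinite or empty; the empty intersection is the whole space. *)
Definition Hconvex (H : set 'rV[R]_d) (C : set 'rV[R]_d) : Prop :=
  exists F : set ('rV[R]_d * R),
    (forall p, F p -> H p.1) /\ C = \bigcap_(p in F) halfspace p.1 p.2.

(* The subfamily of B indexed by A has a point of S in its intersection. *)
Definition meets_in (S : set 'rV[R]_d) (I : finType) (B : I -> set 'rV[R]_d)
    (A : {set I}) : Prop :=
  S `&` \bigcap_(i in [set` A]) B i !=set0.

End HConvex.

(* Main.v *)
(** Matousek's argument that a small dual shatter function gives a fractional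
    Helly theorem.  Membership of x in m given H-convex sets is decided by
    inequalities on <x, h>, at most one threshold for each of the m k pairs
    (set, h).  A linear dependence among d + 1 of the normals h prevents the
    corresponding pairs from being shattered, so by Sauer-Shelah the m sets have
    at most (m k + 1)^d traces on R^d.  If every point of S lay in fewer than
    n/(2m) of the n sets, then for each good (d+1)-tuple J with witness x_J in S,
    at least half of the m-tuples M containing J would have J as the exact trace
    of x_J; averaging over M yields (alpha/2) binom(m, d+1) traces on some M,
    which exceeds (m k + 1)^d once m is large. *)

Require Import Defs.
From HB Require Import structures.
From mathcomp Require Import all_boot all_order all_algebra finmap zify ring.
From mathcomp Require Import mathcomp_extra boolp classical_sets reals.
From mathcomp Require Import fintype finset.

Set Implicit Arguments.
Unset Strict Implicit.
Unset Printing Implicit Defensive.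

Import Order.TTheory GRing.Theory Num.Theory.

(** * Shattering and the Sauer-Shelah bound *)

Definition shatters (T : finType) (F : {set {set T}}) (X : {set T}) : bool :=
  [forall Y : {set T}, (Y \subset X) ==> [exists Z in F, Z :&: X == Y]].

Lemma shattersP (T : finType) (F : {set {set T}}) (X : {set T}) :
  reflect (forall Y : {set T}, Y \subset X -> exists2 Z, Z \in F & Z :&: X = Y)
          (shatters F X).
Proof.
apply: (iffP forallP) => [sFX Y YX | sFX Y].
  by have /implyP/(_ YX)/exists_inP[Z ZF /eqP ZX] := sFX Y; exists Z.
apply/implyP => /sFX[Z ZF ZX].
by apply/exists_inP; exists Z => //; apply/eqP.
Qed.

Lemma shattersS (T : finType) (F G : {set {set T}}) (X : {set T}) :
  F \subset G -> shatters F X -> shatters G X.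
Proof.
move=> /subsetP FG /shattersP sF; apply/shattersP => Y /sF[Z ZF ZX].
by exists Z => //; apply: FG.
Qed.

(* Pajor's strengthening of the Sauer-Shelah lemma. *)
Lemma card_le_shatters (T : finType) (F : {set {set T}}) :
  #|F| <= #|[set X | shatters F X]|.
Proof.
have [n] := ubnP #|F|; elim: n => // n IHn in F *; rewrite ltnS => leFn.
have [F_le1 | ] := leqP #|F| 1.
  have [-> | [Z ZF]] := set_0Vmem F; first by rewrite cards0.
  apply: leq_trans F_le1 _; rewrite card_gt0; apply/set0Pn; exists set0.
  rewrite inE; apply/shattersP => Y; rewrite subset0 => /eqP->.
  by exists Z; rewrite // setI0.
case/card_gt1P => A [B] [AF BF neqAB].
wlog [x xA xNB]: A B AF BF neqAB / exists2 x, x \in A & x \notin B.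
  move=> gen; have [AB | /subsetPn ?] := boolP (A \subset B); last exact: (gen A B).
  have [BA | /subsetPn ?] := boolP (B \subset A).
    by rewrite eqEsubset AB BA in neqAB.
  by apply: (gen B A) => //; rewrite eq_sym.
pose F1 := [set Z in F | x \in Z]; pose F0 := [set Z in F | x \notin Z].
have F1F : F1 \subset F by apply/subsetP => Z; rewrite inE => /andP[].
have F0F : F0 \subset F by apply/subsetP => Z; rewrite inE => /andP[].
have cardF : #|F1| + #|F0| = #|F|.
  rewrite -(cardsID [set Z : {set T} | x \in Z] F).
  by congr (_ + _); apply: eq_card => Z; rewrite !inE // andbC.
have F1_gt0 : 0 < #|F1| by apply/card_gt0P; exists A; rewrite inE AF.
have F0_gt0 : 0 < #|F0| by apply/card_gt0P; exists B; rewrite inE BF.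
have {}IHn (G : {set {set T}}) : #|G| < #|F| -> #|G| <= #|[set X | shatters G X]|.
  by move=> /leq_trans /(_ leFn); apply: IHn.
have le1 : #|F1| <= #|[set X | shatters F1 X]|.
  by apply: IHn; rewrite -cardF -addn1 leq_add2l.
have le0 : #|F0| <= #|[set X | shatters F0 X]|.
  by apply: IHn; rewrite -cardF addnC -addn1 leq_add2l.
set s1 := [set X | shatters F1 X] in le1.
set s0 := [set X | shatters F0 X] in le0.
have xNs1 X : X \in s1 -> x \notin X.
  rewrite inE => /shattersP/(_ _ (sub0set X))[Z].
  rewrite inE => /andP[_ xZ] ZX; apply/negP => xX.
  by have := in_set0 x; rewrite -ZX inE xZ xX.
have xNs0 X : X \in s0 -> x \notin X.
  rewrite inE => /shattersP/(_ _ (subxx X))[Z].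
  rewrite inE => /andP[_ xZ] ZX; apply/negP => xX.
  by move: xX; rewrite -ZX inE (negPf xZ).
(* If [F1] and [F0] both shatter X, then [F] also shatters [x |: X]: traces containing x come from
   [F1], the others from [F0]. These new sets contain x, so they lie outside [s1] and [s0] and make
   up for the overlap [s1 :&: s0] in the count. *)
pose s10 := [set x |: X | X in s1 :&: s0].
have card_s10 : #|s10| = #|s1 :&: s0|.
  apply: card_in_imset => X Y /setIP[/xNs1 xX _] /setIP[/xNs1 xY _] eqXY.
  by rewrite -(setU1K xX) -(setU1K xY) eqXY.
have dis : [disjoint (s1 :|: s0) & s10].
  apply/pred0P => X /=; apply/negP => /andP[/setUP xX /imsetP[Y _ eqX]].
  have : x \notin X by case: xX => [/xNs1|/xNs0].
  by rewrite eqX setU11.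
rewrite -cardF (leq_trans (leq_add le1 le0)) // -cardsUI -card_s10.
have := leq_card_setU (s1 :|: s0) s10; rewrite dis => -[_ /eqP <-].
apply: subset_leq_card; apply/subsetP => X.
case/setUP => [/setUP[]|/imsetP[Y /setIP[Y1 Y0] ->]]; rewrite ?inE.
- exact: shattersS.
- exact: shattersS.
have xY := xNs1 _ Y1; move: Y1 Y0; rewrite !inE.
move=> /shattersP Y1 /shattersP Y0; apply/shattersP => W WxY.
have WY : W :\ x \subset Y by rewrite subDset.
have [xW | xW] := boolP (x \in W).
  have [Z] := Y1 _ WY; rewrite inE => /andP[ZF xZ] ZY; exists Z => //.
  rewrite setIUr ZY; apply/setP => z; rewrite !inE.
  by case: eqVneq => [->|]; rewrite ?xZ ?xW // andbF.
have [Z] := Y0 _ WY; rewrite inE => /andP[ZF xZ] ZY; exists Z => //.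
rewrite setIUr ZY; apply/setP => z; rewrite !inE.
by case: eqVneq => [->|]; rewrite ?(negPf xZ) ?(negPf xW) // andbF.
Qed.

Lemma card_subsets_le (T : finType) (E : {set T}) (d : nat) :
  #|[set X : {set T} | (X \subset E) && (#|X| <= d)]| <= #|E|.+1 ^ d.
Proof.
(* The power is expanded binomially, and the subsets of size i are charged to its i-th term, via
   C(|E|, i) <= |E|^i <= C(d, i) |E|^i. *)
rewrite -[X in X ^ d]addn1 addnC expnDn -sum1_card.
rewrite (partition_big (fun X : {set T} => inord #|X| : 'I_d.+1) xpredT) //=.
apply: leq_sum => i _; rewrite exp1n mul1n.
apply: (@leq_trans 'C(#|E|, i)).
  rewrite sum1_card -cards_draws; apply: subset_leq_card; apply/subsetP => X.
  rewrite unfold_in !inE => /andP[/andP[-> Xd] /eqP <-].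
  by rewrite inordK ?ltnS ?eqxx.
have leCe : 'C(#|E|, i) <= #|E| ^ i.
  apply: (@leq_trans (#|E| ^_ i)); first by rewrite -bin_ffact leq_pmulr ?fact_gt0.
  elim: (nat_of_ord i) => // j IH; rewrite ffactnSr expnSr.
  by rewrite leq_mul ?leq_subr.
by rewrite (leq_trans leCe) // leq_pmull // bin_gt0 -ltnS.
Qed.

Lemma sauer_shelah (T : finType) (E : {set T}) (F : {set {set T}}) (d : nat) :
    (forall Z, Z \in F -> Z \subset E) ->
    (forall X, shatters F X -> #|X| <= d) ->
  #|F| <= #|E|.+1 ^ d.
Proof.
move=> FE Fd; rewrite (leq_trans (card_le_shatters F)) //.
apply: leq_trans (card_subsets_le E d).
apply: subset_leq_card; apply/subsetP => X; rewrite !inE => sX.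
rewrite Fd // andbT; have /shattersP/(_ _ (subxx X))[Z /FE ZE <-] := sX.
exact: subset_trans (subsetIl _ _) ZE.
Qed.

(** * Binomial estimates and the averaging over m-sets *)

Lemma bin_subn_ge n t s : 2 * (t * s) <= n -> 'C(n, s) <= 2 * 'C(n - t, s).
Proof.
move=> ts_le; case: s ts_le => [|s] ts_le; first by rewrite !bin0.
case: n ts_le => [|n] ts_le.
  by rewrite sub0n leq_pmull.
(* Each point deleted from an N-set, N = n + 1, destroys at most C(N - 1, s) of its (s + 1)-subsets.
   Deleting t points thus loses at most t (s + 1) / N of all C(N, s + 1), which is at most half by
   [ts_le]. *)
have dec u : u <= n.+1 -> 'C(n.+1, s.+1) <= 'C(n.+1 - u, s.+1) + u * 'C(n, s).
  elim: u => [|u IHu] u_le; first by rewrite subn0 addn0.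
  apply: leq_trans (IHu (ltnW u_le)) _.
  rewrite subSS subSn // binS mulSn -addnA leq_add2l leq_add2r.
  by apply: leq_bin2l; rewrite leq_subr.
have t_le : t <= n.+1.
  by apply: leq_trans ts_le; rewrite (leq_trans (leq_pmulr _ (ltn0Sn s))) ?leq_pmull.
rewrite -(leq_pmul2l (ltn0Sn n)) -(leq_add2r (n.+1 * 'C(n.+1, s.+1))).
rewrite addnn -mul2n.
have h1 := mul_bin_diag n.+1 s.
have h2 : 2 * (n.+1 * 'C(n.+1, s.+1))
   <= 2 * (n.+1 * 'C(n.+1 - t, s.+1)) + 2 * (t * s.+1) * 'C(n.+1, s.+1).
  rewrite -!mulnA -h1 -mulnDr leq_mul2l /= [t * _]mulnCA -mulnDr.
  by rewrite leq_mul2l dec.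
rewrite (leq_trans h2) // mulnCA leq_add2l.
by rewrite leq_mul2r ts_le orbT.
Qed.

Lemma bin_mul_trinomial n m r : r <= m -> m <= n ->
  'C(n, m) * 'C(m, r) = 'C(n, r) * 'C(n - r, m - r).
Proof.
move=> rm mn; have rn := leq_trans rm mn.
have h : 0 < r`! * (m - r)`! * (n - m)`! by rewrite !muln_gt0 !fact_gt0.
apply/eqP; rewrite -(eqn_pmul2r h); apply/eqP.
transitivity (n`!).
  rewrite -(bin_fact mn) -(bin_fact rm); nia.
have e : n - r - (m - r) = n - m by rewrite subnBA // subnK.
rewrite -(bin_fact rn) -(bin_fact (leq_sub2r r mn)) e; nia.
Qed.

(** Double counting of the pairs (J, M) with |M| = m and [T J :&: M = J]. Each M occurs in at most Q
    pairs. Each J occurs with every [J :|: D], where D is an (m - r)-set disjoint from [T J], hence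
    in at least C(n - r, m - r) / 2 pairs. [bin_mul_trinomial] converts the resulting ratio of
    binomials. *)
Lemma card_traces_le (I : finType) (r m Q : nat) (P : {set {set I}})
    (T : {set I} -> {set I}) :
    r <= m -> m <= #|I| ->
    (forall J, J \in P ->
       [/\ #|J| = r, J \subset T J & 2 * (#|T J| * m) <= #|I|]) ->
    (forall M : {set I}, #|M| = m -> #|[set J in P | T J :&: M == J]| <= Q) ->
  #|P| * 'C(m, r) <= 2 * Q * 'C(#|I|, r).
Proof.
move=> rm mn PT Q_ub; set n := #|I| in mn PT *.
have ub : \sum_(J in P) #|[set M : {set I} | (#|M| == m) && (T J :&: M == J)]|
            <= 'C(n, m) * Q.
  under eq_bigr do rewrite -sum1dep_card.
  rewrite (exchange_big_dep (fun M : {set I} => #|M| == m)) /=; last first.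
    by move=> J M _ /andP[].
  rewrite -card_draws -sum_nat_const.
  rewrite [leqRHS](eq_bigl (fun M : {set I} => #|M| == m)); last first.
    by move=> M; rewrite inE.
  apply: leq_sum => M mM; rewrite (leq_trans _ (Q_ub M (eqP mM))) //.
  rewrite sum1dep_card; apply: subset_leq_card; apply/subsetP => J.
  by rewrite !inE mM.
have lb : #|P| * 'C(n - r, m - r)
    <= 2 * \sum_(J in P) #|[set M : {set I} | (#|M| == m) && (T J :&: M == J)]|.
  rewrite -sum_nat_const big_distrr /=; apply: leq_sum => J JP.
  have [Jr JT Tm] := PT _ JP.
  (* Passing to all n points lets [bin_subn_ge] delete the whole of [T J], J included. *)
  apply: (@leq_trans 'C(n, m - r)); first by rewrite leq_bin2l ?leq_subr.
  apply: (@leq_trans (2 * 'C(n - #|T J|, m - r))).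
    apply: bin_subn_ge; apply: leq_trans Tm.
    by rewrite leq_mul2l leq_mul2l leq_subr !orbT.
  have <- : #|~: T J| = n - #|T J| by rewrite cardsCs setCK.
  rewrite leq_mul2l -cards_draws /=.
  rewrite -(@card_in_imset _ _ (fun D => J :|: D)); last first.
    move=> D D'; rewrite !inE => /andP[DT _] /andP[DT' _] eqD.
    have dropJ (K : {set I}) : K \subset ~: T J -> (J :|: K) :\: T J = K.
      move=> KT; rewrite setDUl; move: (JT); rewrite -setD_eq0 => /eqP->.
      by rewrite set0U setDE; apply/setIidPl.
    by rewrite -(dropJ _ DT) -(dropJ _ DT') eqD.
  apply: subset_leq_card; apply/subsetP => _ /imsetP[D + ->].
  rewrite !inE => /andP[DT /eqP Dm].
  have TD : T J :&: D = set0.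
    by apply/eqP; rewrite setI_eq0 disjoint_sym disjoints_subset.
  have JD : J :&: D = set0.
    by apply/eqP; rewrite -subset0 -TD setSI.
  rewrite cardsU JD cards0 subn0 Jr Dm subnKC // eqxx /=.
  by rewrite setIUr TD setU0; apply/eqP/setIidPr.
have Cnm : 0 < 'C(n, m) by rewrite bin_gt0.
rewrite -(leq_pmul2l Cnm) mulnCA bin_mul_trinomial //.
apply: (@leq_trans (2 * ('C(n, m) * Q) * 'C(n, r))); last by lia.
rewrite mulnCA mulnC leq_mul2r (leq_trans lb) ?orbT //.
by rewrite leq_mul2l ub.
Qed.

Lemma expn_ffact_le n r : (n - r) ^ r.+1 <= n ^_ r.+1.
Proof.
elim: r => [|r IHr]; first by rewrite subn0 ffactn1.
rewrite ffactnSr expnSr leq_mul // (leq_trans _ IHr) //.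
by rewrite leq_exp2r // leq_sub2l.
Qed.

Local Open Scope classical_set_scope.
Local Open Scope ring_scope.

(** * Traces of H-convex sets *)

Lemma row_dependence (K : fieldType) (n d : nat) (A : 'M[K]_(n, d)) :
  (d < n)%N -> exists2 l : 'rV[K]_n, l != 0 & l *m A = 0.
Proof.
move=> dn; have /rowV0Pn[l lA l0] : kermx A != 0.
  by rewrite -mxrank_eq0 mxrank_ker subn_eq0 -ltnNge (leq_ltn_trans (rank_leq_col A)).
by exists l => //; apply/sub_kermxP.
Qed.

Lemma sum_dot_mulmx (R : realType) (n d : nat) (l : 'rV[R]_n)
    (A : 'M[R]_(n, d)) (x : 'rV[R]_d) :
  \sum_j l 0 j * dot x (row j A) = dot x (l *m A).
Proof.
rewrite /dot; under eq_bigr do rewrite mulr_sumr.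
rewrite exchange_big /=; apply: eq_bigr => i _.
rewrite mxE mulr_sumr; apply: eq_bigr => j _.
by rewrite mxE mulrCA.
Qed.

(* Given a linear dependence among the normals of a shattered set, the points x
   and y realizing its positive part and its complement make every term of
   sum_j l_j <y - x, v_j> = 0 nonnegative, and positive where l_j != 0. *)
Lemma shatters_halfspaces (R : realType) (d : nat) (T : finType)
    (v : T -> 'rV[R]_d) (D : T -> R -> Prop) (F : {set {set T}}) (X : {set T}) :
    (forall p s t, s <= t -> D p t -> D p s) ->
    (forall Z, Z \in F ->
       exists x, forall p, (p \in Z) = `[< D p (dot x (v p)) >]) ->
  shatters F X -> (#|X| <= d)%N.
Proof.
move=> Ddown FD /shattersP sX; rewrite leqNgt; apply/negP => dX.
pose A := \matrix_(j < #|X|) v (enum_val j).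
have [l l0 lA] := row_dependence A dX.
pose Y := [set enum_val j | j : 'I_#|X| & 0 < l 0 j]%SET.
have memY j : (enum_val j \in Y) = (0 < l 0 j).
  by rewrite mem_imset ?inE //; apply: enum_val_inj.
have YX : Y \subset X.
  by apply/subsetP => _ /imsetP[j _ ->]; apply: enum_valP.
have [Z1 /FD[x xZ] Z1X] := sX _ YX.
have [Z2 /FD[y yZ] Z2X] := sX (X :\: Y)%SET (subsetDl _ _).
have xE j : `[< D (enum_val j) (dot x (row j A)) >] = (0 < l 0 j).
  by rewrite rowK -xZ -memY -Z1X inE enum_valP andbT.
have yE j : `[< D (enum_val j) (dot y (row j A)) >] = ~~ (0 < l 0 j).
  rewrite rowK -yZ -memY; have := enum_valP j.
  by move=> jX; have := in_setD X Y (enum_val j); rewrite -Z2X inE jX !andbT.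
(* As [D p] is closed downwards, any value satisfying it lies strictly below any value violating
   it. *)
have gap p s t : `[< D p s >] -> ~~ `[< D p t >] -> s < t.
  move=> /asboolP Ds /asboolP Dt; rewrite ltNge; apply/negP => ts.
  exact/Dt/(Ddown _ _ _ ts).
have pos j : l 0 j != 0 -> 0 < l 0 j * (dot y (row j A) - dot x (row j A)).
  have [lj|lj|_] := ltgtP (l 0 j) 0; last by [].
    move=> _; rewrite nmulr_rgt0 // subr_lt0.
    by apply: (gap (enum_val j)); rewrite ?yE ?xE -leNgt ltW.
  move=> _; rewrite pmulr_rgt0 // subr_gt0.
  by apply: (gap (enum_val j)); rewrite ?yE ?xE ?lj.
have sum0 : \sum_j l 0 j * (dot y (row j A) - dot x (row j A)) = 0.
  under eq_bigr do rewrite mulrBr.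
  rewrite big_split /= sumrN !sum_dot_mulmx lA.
  by rewrite /dot !big1 ?subrr // => i _; rewrite mxE mulr0.
move/negP: l0; apply; apply/eqP/rowP => j; rewrite [RHS]mxE.
apply/eqP/negPn/negP => /pos; rewrite lt0r => /andP[/eqP + _]; apply.
apply: (psumr_eq0P _ sum0) => // i _.
by have [->|/pos/ltW //] := eqVneq (l 0 i) 0; rewrite mul0r.
Qed.

(** For each normal h, the halfspaces defining [B i] impose a downward closed condition on <x, h>.
    Keeping this condition instead of a threshold covers infinite families and directions without
    any halfspace. A trace J is recovered from the set of pairs (i, h) whose condition [x J] meets,
    so Sauer-Shelah on M x H bounds the number of traces. *)
Lemma card_Hconvex_traces (R : realType) (d : nat) (H : {fset 'rV[R]_d})
    (I : finType) (B : I -> set 'rV[R]_d) (M : {set I}) (P : {set {set I}})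
    (x : {set I} -> 'rV[R]_d) :
    (forall i, Hconvex [set` H] (B i)) ->
    (forall J, J \in P -> [set i in M | `[< B i (x J) >]]%SET = J) ->
  (#|P| <= (#|M| * #|` H|).+1 ^ d)%N.
Proof.
move=> /choice[F FP] PM.
(* The condition p.1 \in M, constant in t, confines the sets Z J to M x H. *)
pose D (p : I * H) t := p.1 \in M /\ forall c, F p.1 (val p.2, c) -> t <= c.
pose Z J := [set p : I * H | `[< D p (dot (x J) (val p.2)) >]]%SET.
have BE i y : B i y <-> forall h : H, forall c, F i (val h, c) -> dot y (val h) <= c.
  have [FH ->] := FP i; split=> [By h c Fhc|By [h c] Fhc]; first exact: By Fhc.
  by have hH : h \in H := FH _ Fhc; apply: (By [` hH]%fset).
have memZ J i : J \in P -> (i \in J) = (i \in M) && [forall h : H, (i, h) \in Z J].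
  move=> JP; rewrite -{1}(PM _ JP) inE; case iM: (i \in M) => //=.
  apply/asboolP/forallP => [/BE Bi h|Zi].
    by rewrite inE; apply/asboolP; split=> //=; apply: Bi.
  by apply/BE => h; have := Zi h; rewrite inE => /asboolP[].
have Zinj : {in P &, injective Z}.
  by move=> J J' JP JP' ZJ; apply/setP => i; rewrite (memZ _ _ JP) (memZ _ _ JP') ZJ.
rewrite -(card_in_imset Zinj) cardfE -cardsT -cardsX.
apply: sauer_shelah => [_ /imsetP[J _ ->]|Y].
  by apply/subsetP => p; rewrite !inE => /asboolP[->].
apply: (@shatters_halfspaces _ _ _ (fun p => val p.2) D).
  move=> p s t st [pM Dt]; split=> // c /Dt; exact: le_trans.
by move=> _ /imsetP[J _ ->]; exists (x J) => p; rewrite inE.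
Qed.

(** * Choice of m and the final contradiction *)

Lemma bin_beats_expn (R : realType) (alpha : R) (d k : nat) :
  0 < alpha -> exists2 m : nat,
    (d < m)%N & 2 * ((m * k).+1 ^ d)%:R < alpha * 'C(m, d.+1)%:R.
Proof.
(* With m = d + q and q >= 1, mk + 1 <= c q, while C(m, d + 1) (d + 1)! >= q^(d + 1). After
   cancelling q^d the claim reduces to b < q. *)
move=> alpha0; pose c := (d.+1 * k).+1.
pose b : R := 2 * (d.+1)`!%:R * (c ^ d)%:R / alpha.
have b_ge0 : 0 <= b by rewrite divr_ge0 ?mulr_ge0 ?ler0n ?ltW.
have := archi_boundP b_ge0; set q := Num.bound b => bq.
have q_gt0 : (0 < q)%N by rewrite -(ltr_nat R) (le_lt_trans b_ge0).
exists (d + q)%N; first by rewrite -addn1 leq_add2l.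
have le1 : (((d + q) * k).+1 ^ d <= c ^ d * q ^ d)%N.
  have le0 : (((d + q) * k).+1 <= c * q)%N by rewrite /c; nia.
  by rewrite -expnMn; have [->|d0] := posnP d; rewrite ?expn0 ?leq_exp2r.
have le2 : (q ^ d * q <= 'C(d + q, d.+1) * (d.+1)`!)%N.
  by rewrite bin_ffact -expnSr -{1}(addKn d q) expn_ffact_le.
have fact0 : 0 < (d.+1)`!%:R :> R by rewrite ltr0n fact_gt0.
rewrite -(ltr_pM2r fact0).
apply: (@le_lt_trans _ _ (2 * (c ^ d * q ^ d)%:R * (d.+1)`!%:R)).
  by rewrite ler_pM2r // ler_pM2l // ler_nat.
apply: (@lt_le_trans _ _ (alpha * (q ^ d * q)%:R)); last first.
  by rewrite -mulrA -natrM ler_pM2l // ler_nat.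
have qd0 : 0 < (q ^ d)%:R :> R by rewrite ltr0n expn_gt0 q_gt0.
have -> : 2 * (c ^ d * q ^ d)%:R * (d.+1)`!%:R = (q ^ d)%:R * (alpha * b).
  by rewrite /b [alpha * _]mulrC divfK ?gt_eqF // natrM; ring.
by rewrite natrM mulrCA ltr_pM2l // ltr_pM2l.
Qed.

Theorem theorem5p5 (R : realType) (d : nat) (hd : (0 < d)%N) (k : nat)
    (alpha : R) (halpha0 : 0 < alpha) (halpha1 : alpha < 1) :
  exists beta : R, 0 < beta /\
    forall H : {fset 'rV[R]_d},
      #|` H| = k ->
      [set` H] `<=` unit_sphere ->
      (forall u : 'rV[R]_d, unit_sphere u ->
         ~ [set` H] `<=` closed_half_sphere u) ->
    forall (S : {fset 'rV[R]_d}) (I : finType) (B : I -> set 'rV[R]_d),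
      (d.+1 <= #|I|)%N ->
      (forall i, Hconvex [set` H] (B i)) ->
      alpha * 'C(#|I|, d.+1)%:R <=
        #|[pred A : {set I} | (#|A| == d.+1) && `[< meets_in [set` S] B A >]]|%:R ->
    exists A : {set I},
      beta * #|I|%:R <= #|A|%:R /\ meets_in [set` S] B A.

Proof.
have [m dm m_large] := bin_beats_expn d k halpha0.
have m2_gt0 : 0 < (2 * m)%:R :> R by rewrite ltr0n muln_gt0 (leq_trans _ dm).
(* m depends only on alpha, d and k, so this value serves all H, S and B. *)
exists (2 * m)%:R^-1; split; first by rewrite invr_gt0.
move=> H Hk _ _ S I B dI Bconv; set p := [pred A | _].
set n := #|I| in dI *; pose P := [set A in p]%SET.
have <- : #|P| = #|p| by apply: cardsE.
move=> alphaP; apply: contrapT => noA.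
have small (A : {set I}) : meets_in [set` S] B A -> (#|A| * (2 * m) < n)%N.
  move=> SA; rewrite ltnNge; apply/negP => nA; apply: noA; exists A; split=> //.
  by rewrite mulrC ler_pdivrMr // -natrM ler_nat.
(* A single good tuple, nonempty and itself subject to [small], already forces n to be large, so
   families with few sets need no separate case. *)
have n_ge2m : (2 * m < n)%N.
  have [A] : exists A, A \in P.
    apply/card_gt0P; rewrite -(ltr0n R) (lt_le_trans _ alphaP) //.
    by rewrite mulr_gt0 // ltr0n bin_gt0.
  rewrite !inE => /andP[/eqP Ad /asboolP/small].
  by apply: leq_ltn_trans; rewrite Ad leq_pmull.
have /choice[x xP] : forall J : {set I}, exists y : 'rV[R]_d, J \in P ->
    [set` S] y /\ forall i, i \in J -> B i y.
  move=> J; have [|] := boolP (J \in P); last by exists 0.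
  by rewrite !inE => /andP[_ /asboolP[y [Sy BJ]]]; exists y.
pose T J := [set i | `[< B i (x J) >]]%SET.
have mn : (m <= n)%N by apply: leq_trans (ltnW n_ge2m); rewrite leq_pmull.
have : (#|P| * 'C(m, d.+1) <= 2 * (m * k).+1 ^ d * 'C(n, d.+1))%N.
  apply: (@card_traces_le I d.+1 m _ P T) => // [J JP|M mM].
    have [Sx BJ] := xP J JP.
    split; first by move: JP; rewrite !inE => /andP[/eqP].
      by apply/subsetP => i iJ; rewrite inE; apply/asboolP/BJ.
    rewrite mulnCA; apply/ltnW/small; exists (x J); split=> // i /=.
    by rewrite inE => /asboolP.
  rewrite -mM -Hk; apply: (card_Hconvex_traces (B := B) (x := x)) => // J.
  rewrite inE => /andP[_ /eqP {2}<-].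
  by apply/setP => i; rewrite !inE andbC.
(* By [alphaP], |P| C(m, d + 1) is at least alpha C(m, d + 1) C(n, d + 1), which exceeds the upper
   bound by the choice of m. *)
apply/negP; rewrite -ltnNge -(ltr_nat R) !natrM.
have Cnd : 0 < 'C(n, d.+1)%:R :> R by rewrite ltr0n bin_gt0.
apply: (@lt_le_trans _ _ (alpha * 'C(m, d.+1)%:R * 'C(n, d.+1)%:R)).
  by rewrite ltr_pM2r.
by rewrite mulrAC ler_wpM2r.
Qed.
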